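(* Let $\{S_\lambda:\lambda\geq0\}$ and $\{T_\mu:\mu\geq0\}$ be strongly continuous semigroups of isometries on a Hilbert space $\mathcal{H}$ satisfying $S_\lambda T_\mu=e^{i\lambda\mu}T_\mu S_\lambda$ for all $\lambda,\mu\geq0$. Then there exist a Hilbert space $\mathcal{K}\supseteq\mathcal{H}$ and strongly continuous unitary groups $\{U_\lambda:\lambda\in\mathbb{R}\}$, $\{V_\mu:\mu\in\mathbb{R}\}$ on $\mathcal{K}$ satisfying $U_\lambda V_\mu=e^{i\lambda\mu}V_\mu U_\lambda$ for all real $\lambda,\mu$, such that $P_{\mathcal{H}}U_\lambda|_{\mathcal{H}}=S_\lambda$ and $P_{\mathcal{H}}V_\mu|_{\mathcal{H}}=T_\mu$ for all $\lambda,\mu\geq0$, where $P_{\mathcal{H}}$ is the orthogonal projection of $\mathcal{K}$ onto $\mathcal{H}$. *)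

(* Defs.v *)
From HB Require Import structures.
From mathcomp Require Import all_boot all_order all_algebra.
From mathcomp Require Import complex.
From mathcomp Require Import reals trigo.

Set Implicit Arguments.
Unset Strict Implicit.
Unset Printing Implicit Defensive.

Import Order.TTheory GRing.Theory Num.Theory.
Local Open Scope ring_scope.

Record hilbertSpace (R : realType) := HilbertSpace {
  hcar :> lmodType R[i];
  hinner : hcar -> hcar -> R[i];
  hinner_linear : forall (a : R[i]) (x y z : hcar),
      hinner (a *: x + y) z = a * hinner x z + hinner y z;
  hinner_conj : forall x y : hcar, hinner y x = (hinner x y)^*;
  hinner_ge0 : forall x : hcar, 0 <= hinner x x;
  hinner_eq0 : forall x : hcar, hinner x x = 0 -> x = 0;
  hcomplete : forall u : nat -> hcar,
      (forall e : R, 0 < e -> exists N : nat, forall m n : nat,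
          (N <= m)%N -> (N <= n)%N ->
          Num.sqrt (complex.Re (hinner (u m - u n) (u m - u n))) < e) ->
      exists l : hcar, forall e : R, 0 < e -> exists N : nat, forall n : nat,
          (N <= n)%N -> Num.sqrt (complex.Re (hinner (u n - l) (u n - l))) < e
}.

Section HilbertDefs.
Variable R : realType.

Definition hnorm (H : hilbertSpace R) (x : H) : R :=
  Num.sqrt (complex.Re (hinner x x)).

Definition expi (t : R) : R[i] := Complex (cos t) (sin t).

Definition linear_op (H K : hilbertSpace R) (f : H -> K) : Prop :=
  forall (a : R[i]) (x y : H), f (a *: x + y) = a *: f x + f y.

Definition isometry_op (H K : hilbertSpace R) (f : H -> K) : Prop :=
  linear_op f /\ forall x : H, hnorm (f x) = hnorm x.

Definition unitary_op (H : hilbertSpace R) (f : H -> H) : Prop :=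
  isometry_op f /\ forall y : H, exists x : H, f x = y.

Definition strongly_continuous_on (H : hilbertSpace R) (D : R -> Prop)
    (A : R -> H -> H) : Prop :=
  forall (x : H) (t0 : R), D t0 -> forall e : R, 0 < e ->
    exists2 d : R, 0 < d & forall t : R, D t -> `|t - t0| < d ->
      hnorm (A t x - A t0 x) < e.

(* strongly continuous one-parameter semigroup {S_l : l >= 0} of isometries;
   the values of S at negative parameters are irrelevant *)
Definition isometry_semigroup (H : hilbertSpace R) (S : R -> H -> H) : Prop :=
  [/\ forall x : H, S 0 x = x,
      forall (a b : R) (x : H), 0 <= a -> 0 <= b -> S (a + b) x = S a (S b x),
      forall l : R, 0 <= l -> isometry_op (S l)
    & strongly_continuous_on (fun l => 0 <= l) S].

Definition unitary_group (H : hilbertSpace R) (U : R -> H -> H) : Prop :=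
  [/\ forall x : H, U 0 x = x,
      forall (a b : R) (x : H), U (a + b) x = U a (U b x),
      forall l : R, unitary_op (U l)
    & strongly_continuous_on (fun _ => True) U].

(* J : H -> K identifies H with a closed subspace of K (inner products
   preserved, linear) *)
Definition hembedding (H K : hilbertSpace R) (J : H -> K) : Prop :=
  linear_op J /\ forall x y : H, hinner (J x) (J y) = hinner x y.

(* P_H A |_H = B, where H is identified with J(H) inside K:
   <A (J x), J y> = <B x, y> for all x, y in H, i.e. J^* A J = B. *)
Definition compression (H K : hilbertSpace R) (J : H -> K)
    (A : K -> K) (B : H -> H) : Prop :=
  forall x y : H, hinner (A (J x)) (J y) = hinner (B x) y.

End HilbertDefs.

(* Main.v *)
(**
A vector k of a dilation is determined by the family f(a, b) = P_H U_a V_b k,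
indexed by all real a and b. Such a family is bounded and satisfies
<f(a+l, b), S_l y> = <f(a, b), y> and
<f(a, b+m), T_m y> = e^{iam} <f(a, b), y> for l, m >= 0, and these conditions
are taken as the definition of the dilation space K. The first relation makes
S_l f(a, b) the projection of f(a+l, b) onto the range of S_l, and similarly for
T_m, so |f(a, b)| is nondecreasing in a and b and
<f, g> = lim <f(a, b), g(a, b)> as a, b -> +oo exists. The unitary groups are the
translations (U_l f)(a, b) = e^{-ilb} f(a+l, b) and (V_m f)(a, b) = f(a, b+m), for
which the group law and the Weyl relation are immediate. Since f is determined up
to a small error by one value f(a, b) with a and b large, their strong continuity
reduces to that of S and T. A vector x of H is sent to the family with
f(a, b) = S_a T_b x for a, b >= 0, extended to all (a, b) by the Riesz theorem.
*)

Require Import Defs.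
From HB Require Import structures.
From mathcomp Require Import all_boot all_order all_algebra.
From mathcomp Require Import complex.
From mathcomp Require Import boolp classical_sets functions.
From mathcomp Require Import reals topology normedtype trigo.
From mathcomp Require Import ring lra.

Set Implicit Arguments.
Unset Strict Implicit.
Unset Printing Implicit Defensive.
Import Order.TTheory GRing.Theory Num.Theory.
Import numFieldNormedType.Exports.
Local Open Scope ring_scope.

(** * Hilbert space preliminaries *)

Section InnerProduct.
Variables (R : realType) (H : hilbertSpace R).
Implicit Types (x y z : H) (a b : R[i]).

Lemma hinnerDl x y z : hinner (x + y) z = hinner x z + hinner y z.
Proof. by have := hinner_linear 1 x y z; rewrite scale1r mul1r. Qed.

Lemma hinner0l z : hinner (0 : H) z = 0.
Proof. by apply: (addrI (hinner (0 : H) z)); rewrite -hinnerDl !addr0. Qed.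

Lemma hinnerZl a x z : hinner (a *: x) z = a * hinner x z.
Proof. by have := hinner_linear a x 0 z; rewrite addr0 hinner0l addr0. Qed.

Lemma hinnerDr x y z : hinner x (y + z) = hinner x y + hinner x z.
Proof. by rewrite hinner_conj hinnerDl rmorphD /= -!hinner_conj. Qed.

Lemma hinnerZr a x y : hinner x (a *: y) = a^* * hinner x y.
Proof. by rewrite hinner_conj hinnerZl rmorphM /= -hinner_conj. Qed.

Definition rinner x y : R := complex.Re (hinner x y).

Lemma rinnerC x y : rinner x y = rinner y x.
Proof. by rewrite /rinner hinner_conj; case: hinner. Qed.

Lemma rinnerDl x y z : rinner (x + y) z = rinner x z + rinner y z.
Proof. by rewrite /rinner hinnerDl; do 2 case: hinner => ? ?. Qed.

Lemma rinnerDr x y z : rinner x (y + z) = rinner x y + rinner x z.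
Proof. by rewrite rinnerC rinnerDl !(rinnerC x). Qed.

Lemma rinnerNl x z : rinner (- x) z = - rinner x z.
Proof. by rewrite /rinner -scaleN1r hinnerZl mulN1r; case: hinner. Qed.

Lemma rinnerNr x z : rinner x (- z) = - rinner x z.
Proof. by rewrite rinnerC rinnerNl rinnerC. Qed.

Definition rinnerE := (rinnerDl, rinnerDr, rinnerNl, rinnerNr).

Lemma rinner_scalel (t : R) x y : rinner (Complex t 0 *: x) y = t * rinner x y.
Proof. by rewrite /rinner hinnerZl; case: hinner => ? ? /=; lra. Qed.

Lemma rinner_scaler (t : R) x y : rinner x (Complex t 0 *: y) = t * rinner x y.
Proof. by rewrite rinnerC rinner_scalel rinnerC. Qed.

(** The inner product is conjugate linear in its second argument, so multiplying [y] by i turns the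
    imaginary part into a real part. Limits and estimates then need only be made for [rinner]. *)
Lemma Im_hinner x y : complex.Im (hinner x y) = rinner x (Complex 0 1 *: y).
Proof. by rewrite /rinner hinnerZr; case: hinner => ? ? /=; lra. Qed.

Lemma hinnerE x y :
  hinner x y = Complex (rinner x y) (rinner x (Complex 0 1 *: y)).
Proof. by rewrite -Im_hinner /rinner; case: hinner. Qed.

Lemma rinner_ge0 x : 0 <= rinner x x.
Proof. by have := hinner_ge0 x; rewrite /rinner lecE => /andP[]. Qed.

Lemma rinner_eq0 x : rinner x x = 0 -> x = 0.
Proof.
move=> x0; apply: hinner_eq0; have /ger0_Im := hinner_ge0 x.
by move: x0; rewrite /rinner; case: hinner => ? ? /= -> ->.
Qed.

Lemma hinner_inj x y : (forall z, hinner x z = hinner y z) -> x = y.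
Proof.
move=> xy; apply/eqP; rewrite -subr_eq0; apply/eqP/rinner_eq0.
have : rinner x (x - y) = rinner y (x - y) by rewrite /rinner xy.
by rewrite !rinnerE (rinnerC y); lra.
Qed.

Lemma hnorm_ge0 x : 0 <= hnorm x.
Proof. exact: sqrtr_ge0. Qed.

Lemma sqr_hnorm x : hnorm x ^+ 2 = rinner x x.
Proof. exact/sqr_sqrtr/rinner_ge0. Qed.

Lemma hnorm_le x (c : R) : 0 <= c -> (hnorm x <= c) = (rinner x x <= c ^+ 2).
Proof.
by move=> c0; rewrite -sqr_hnorm ler_pXn2r// nnegrE // hnorm_ge0.
Qed.

Lemma hnorm_lt x (c : R) : 0 <= c -> (hnorm x < c) = (rinner x x < c ^+ 2).
Proof.
by move=> c0; rewrite -sqr_hnorm ltr_pXn2r// nnegrE // hnorm_ge0.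
Qed.

Lemma cauchy_schwarz x y : rinner x y ^+ 2 <= rinner x x * rinner y y.
Proof.
have [y0|y0] := eqVneq (rinner y y) 0.
  rewrite (rinner_eq0 y0) /rinner hinner_conj !hinner0l.
  by case: (hinner x x) => ? ? /=; lra.
have yp : 0 < rinner y y by rewrite lt_def y0 rinner_ge0.
(* The squared norm of this vector is |y|^2 (|x|^2 |y|^2 - [rinner x y]^2); no division occurs. *)
have := rinner_ge0 (Complex (rinner y y) 0 *: x - Complex (rinner x y) 0 *: y).
rewrite !rinnerE !(rinner_scalel, rinner_scaler) (rinnerC y x) => h.
have {}h : 0 <= rinner y y * (rinner x x * rinner y y - rinner x y ^+ 2) by nra.
by rewrite pmulr_rge0 // subr_ge0 in h.
Qed.

Lemma rinner_le_hnorm x y : rinner x y <= hnorm x * hnorm y.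
Proof.
apply: le_trans (ler_norm _) _; rewrite -(@ler_pXn2r _ 2)// ?nnegrE//; last first.
  by rewrite mulr_ge0 // hnorm_ge0.
by rewrite real_normK ?num_real// exprMn !sqr_hnorm cauchy_schwarz.
Qed.

Lemma ler_hnormD x y : hnorm (x + y) <= hnorm x + hnorm y.
Proof.
rewrite hnorm_le; last by rewrite addr_ge0 // hnorm_ge0.
rewrite !rinnerE (rinnerC y x).
have := rinner_le_hnorm x y; have := sqr_hnorm x; have := sqr_hnorm y; nra.
Qed.

Lemma hnormN x : hnorm (- x) = hnorm x.
Proof. by rewrite /hnorm -!/(rinner _ _) !rinnerE opprK. Qed.

Lemma ler_hnorm_dist (x y z : H) : hnorm (x - z) <= hnorm (x - y) + hnorm (y - z).
Proof. by apply: le_trans (ler_hnormD _ _); rewrite addrA subrK. Qed.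

Lemma hnorm_dist x y : hnorm (x - y) = hnorm (y - x).
Proof. by rewrite -hnormN opprB. Qed.

Lemma hnormZ a x :
  hnorm (a *: x) = Num.sqrt (complex.Re a ^+ 2 + complex.Im a ^+ 2) * hnorm x.
Proof.
rewrite /hnorm -sqrtrM; last by rewrite addr_ge0 // sqr_ge0.
congr Num.sqrt; rewrite hinnerZl hinnerZr; have /ger0_Im := hinner_ge0 x.
by case: hinner => u v /= ->; case: a => ? ? /=; ring.
Qed.

Lemma polarization x y :
  rinner x y = (rinner (x + y) (x + y) - rinner (x - y) (x - y)) / 4.
Proof. by rewrite !rinnerE (rinnerC y x); lra. Qed.

End InnerProduct.

(** * Unimodular phases *)

Section Phase.
Variable R : realType.
Implicit Types s t : R.

Lemma expiD s t : expi (s + t) = expi s * expi t.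
Proof.
apply/eqP; rewrite eq_complex /= cosD sinD; apply/andP.
by split; apply/eqP; ring.
Qed.

Lemma expi0 : expi (0 : R) = 1.
Proof. by rewrite /expi cos0 sin0. Qed.

Lemma conj_expi t : (expi t)^* = expi (- t).
Proof. by rewrite /expi cosN sinN. Qed.

Lemma hnorm_expi (H : hilbertSpace R) t (x : H) : hnorm (expi t *: x) = hnorm x.
Proof. by rewrite hnormZ /= cos2Dsin2 sqrtr1 mul1r. Qed.

Lemma hnorm_expi_sub (H : hilbertSpace R) t (x : H) :
  hnorm (expi t *: x - x) = Num.sqrt (2 - 2 * cos t) * hnorm x.
Proof.
rewrite -{2}(scale1r x) -scalerBl hnormZ /= subr0; congr (Num.sqrt _ * _).
by have := cos2Dsin2 t; lra.
Qed.

Lemma cos_near0 (e : R) : 0 < e ->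
  exists2 d : R, 0 < d & forall t, `|t| < d -> 2 - 2 * cos t < e.
Proof.
move=> e0.
have /cvgrPdist_lt cosP := @continuous_cos R 0.
have /nbhs_ballP[d /= d0 dP] := cosP (e / 2) ltac:(by rewrite divr_gt0).
exists d => // t td; have := dP t; rewrite /ball /= sub0r normrN => /(_ td).
by rewrite cos0 ltr_norml => /andP[]; lra.
Qed.

End Phase.

(** * The Riesz representation theorem *)

Section Riesz.
Variables (R : realType) (H : hilbertSpace R).

Lemma invn_lt (e : R) : 0 < e ->
  exists N : nat, forall n : nat, (N <= n)%N -> n.+1%:R^-1 < e.
Proof.
move=> e0; have [k] := ltr_add_invr e0; rewrite add0r => ke.
exists k => n kn; apply: le_lt_trans ke.
by rewrite lef_pV2 ?posrE// ler_nat ltnS.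
Qed.

(* The representing vector minimises |y|^2 - 2 Re (phi y). *)
Lemma riesz (phi : H -> R[i]) (c : R) :
  (forall a x y, phi (a *: x + y) = a^* * phi x + phi y) ->
  (forall y, complex.Re (phi y) <= c * hnorm y) ->
  exists z : H, forall y, hinner z y = phi y.
Proof.
move=> phiP phi_le.
have phiD x y : phi (x + y) = phi x + phi y.
  by rewrite -{1}(scale1r x) phiP rmorph1 mul1r.
have phi0 : phi 0 = 0 by apply: (addrI (phi 0)); rewrite -phiD !addr0.
have phiZ a x : phi (a *: x) = a^* * phi x.
  by rewrite -{1}(addr0 (a *: x)) phiP phi0 addr0.
pose psi y := complex.Re (phi y).
have psiD x y : psi (x + y) = psi x + psi y.
  by rewrite /psi phiD; do 2 case: (phi _) => ? ?.
have psiZ (t : R) x : psi (Complex t 0 *: x) = t * psi x.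
  by rewrite /psi phiZ; case: (phi _) => ? ? /=; lra.
pose q y := rinner y y - 2 * psi y.
(* Boundedness of [phi] gives q y >= |y|^2 - 2c|y| = (|y| - c)^2 - c^2. *)
have q_ge y : - c ^+ 2 <= q y.
  rewrite /q -sqr_hnorm; have := phi_le y; rewrite -/(psi y).
  have := sqr_ge0 (hnorm y - c); nra.
pose E := [set r | exists y, r = q y]%classic.
have Einf : has_inf E.
  split; first by exists (q 0), 0.
  by exists (- c ^+ 2) => _ [y ->].
have infq y : inf E <= q y by apply: ge_inf; [exact: Einf.2 | exists y].
have /choice[u uP] : forall n : nat, exists y, q y < inf E + n.+1%:R^-1.
  move=> n; have [||_ [y ->]] := @inf_adherent _ E n.+1%:R^-1 => //.
    by rewrite invr_gt0.
  by exists y.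
(* Parallelogram law: the left side is 2 (q (u m) + q (u n) - 2 q w) with w the midpoint, and q w is
   at least the infimum. *)
have uu m n : rinner (u m - u n) (u m - u n) <= 2 * (m.+1%:R^-1 + n.+1%:R^-1).
  have := infq (Complex (2^-1) 0 *: (u m + u n)).
  have := uP m; have := uP n; rewrite /q psiZ psiD.
  rewrite !(rinner_scalel, rinner_scaler, rinnerE) (rinnerC (u n) (u m)).
  move: (n.+1%:R^-1) (m.+1%:R^-1) => en em; lra.
have [|z zP] := @hcomplete R H u.
  move=> e e0; have [|N NP] := @invn_lt (e ^+ 2 / 4).
    by rewrite divr_gt0// exprn_gt0.
  exists N => m n /NP hm /NP hn; rewrite -/(hnorm _) hnorm_lt ?ltW//.
  apply: le_lt_trans (uu m n) _.
  by move: (n.+1%:R^-1) (m.+1%:R^-1) hm hn => en em; lra.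
exists z.
(* The right side is q (z + t y) - q z. It is obtained by comparing q at u n + t y and at u n and
   letting n grow. *)
have key t y : 0 <= 2 * t * (rinner z y - psi y) + t ^+ 2 * rinner y y.
  apply/ler_addgt0Pr => e e0.
  (* Half of [e] absorbs the defect of q (u n) from the infimum, the other half the error 2 |t| |u n
     - z| |y|. The summand 1 keeps [k] positive. *)
  pose k := 2 * `|t| * hnorm y + 1.
  have k0 : 0 < k by rewrite ltr_pwDr// !mulr_ge0// hnorm_ge0.
  have [|N1 h1] := @invn_lt (e / 2); first by rewrite divr_gt0.
  have [|N2 h2] := zP (e / 2 / k); first by rewrite !divr_gt0.
  pose n := maxn N1 N2.
  have {}h1 : n.+1%:R^-1 < e / 2 by apply: h1; rewrite leq_maxl.
  have {}h2 : hnorm (u n - z) * k < e / 2.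
    by rewrite -ltr_pdivlMr//; apply: h2; rewrite leq_maxr.
  have hz : t * rinner (u n - z) y <= `|t| * (hnorm (u n - z) * hnorm y).
    apply: le_trans (ler_norm _) _; rewrite normrM ler_wpM2l//.
    rewrite ler_norml rinner_le_hnorm andbT lerNl -rinnerNl.
    by rewrite -(hnormN (u n - z)) rinner_le_hnorm.
  have hu : 0 <= hnorm (u n - z) by exact: hnorm_ge0.
  have := infq (u n + Complex t 0 *: y); have := uP n; move: hz h2 h1.
  rewrite /q /k psiD psiZ !rinnerE !(rinner_scalel, rinner_scaler) (rinnerC y).
  by move: (n.+1%:R^-1) => en; nra.
have zpsi y : rinner z y = psi y.
  have N0 := rinner_ge0 y.
  set d := rinner z y - psi y; suff d0 : d = 0 by move: d0; rewrite /d; lra.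
  have N1 : 0 < rinner y y + 1 by lra.
  (* With this t the quadratic expression is negative unless d = 0; the 1 in the denominator also
     covers y = 0. *)
  have := key (- d / (rinner y y + 1)) y; rewrite -/d.
  have -> : 2 * (- d / (rinner y y + 1)) * d +
     (- d / (rinner y y + 1)) ^+ 2 * rinner y y =
     - (d ^+ 2 * (rinner y y + 2)) / (rinner y y + 1) ^+ 2.
    by field; rewrite gt_eqF.
  rewrite ler_pdivlMr ?exprn_gt0// mul0r => h.
  by apply/eqP; rewrite -sqrf_eq0 eq_le sqr_ge0 andbT; nra.
(* Conjugate linearity gives Re (phi (i y)) = Im (phi y), which recovers the imaginary part. *)
move=> y; rewrite hinnerE !zpsi /psi phiZ.
by case: (phi y) => ? ? /=; congr Complex; lra.
Qed.

End Riesz.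

(** * Limits as two real variables tend to infinity together *)

Section LimitAtInfinity.
Variable R : realType.
Implicit Types (F G : R -> R -> R) (L M : R).

Definition lim2 F L := forall e : R, 0 < e ->
  exists s : R, forall a b, s <= a -> s <= b -> `|F a b - L| < e.

Lemma lim2_eq F G L s : (forall a b, s <= a -> s <= b -> F a b = G a b) ->
  lim2 F L -> lim2 G L.
Proof.
move=> FG FL e /FL[s' h]; exists (Num.max s s') => a b.
by rewrite !ge_max => /andP[? ?] /andP[? ?]; rewrite -FG// h.
Qed.

Lemma lim2_cst L : lim2 (fun _ _ => L) L.
Proof. by move=> e e0; exists 0 => a b _ _; rewrite subrr normr0. Qed.

Lemma lim2D F G L M : lim2 F L -> lim2 G M ->
  lim2 (fun a b => F a b + G a b) (L + M).
Proof.
move=> FL GM e e0; have e2 : 0 < e / 2 by rewrite divr_gt0.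
have [s hs] := FL _ e2; have [s' hs'] := GM _ e2.
exists (Num.max s s') => a b; rewrite !ge_max => /andP[sa s'a] /andP[sb s'b].
have := hs _ _ sa sb; have := hs' _ _ s'a s'b.
by rewrite !ltr_norml => /andP[? ?] /andP[? ?]; apply/andP; split; lra.
Qed.

Lemma lim2Z k F L : lim2 F L -> lim2 (fun a b => k * F a b) (k * L).
Proof.
move=> FL e e0; have k0 : 0 < `|k| + 1 by rewrite ltr_pwDr.
have [|s hs] := FL (e / (`|k| + 1)); first by rewrite divr_gt0.
exists s => a b sa sb; have := hs _ _ sa sb; rewrite ltr_pdivlMr// => h.
rewrite -mulrBr normrM; apply: le_lt_trans h.
by rewrite mulrC ler_wpM2l// lerDl.
Qed.

Lemma lim2_le F L M s : (forall a b, s <= a -> s <= b -> F a b <= M) ->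
  lim2 F L -> L <= M.
Proof.
move=> FM FL; apply/ler_addgt0Pr => e /FL[s' h].
have := h (Num.max s s') (Num.max s s'); have := FM (Num.max s s') (Num.max s s').
rewrite !le_max !lexx orbT => /(_ isT isT) ? /(_ isT isT).
by rewrite ltr_norml => /andP[? ?]; lra.
Qed.

Lemma lim2_unique F L M : lim2 F L -> lim2 F M -> L = M.
Proof.
move=> FL FM; apply/eqP; rewrite -subr_eq0 -sqrf_eq0 eq_le sqr_ge0 andbT.
have := lim2D FL (lim2Z (-1) FM).
move=> /(lim2_eq (G := fun _ _ => 0) (s := 0)) h.
have {}h : lim2 (fun _ _ => 0) (L + -1 * M) by apply: h => a b _ _; lra.
have /(lim2_le (M := 0) (s := 0)) h1 := h.
have /(lim2_le (M := 0) (s := 0)) h2 := lim2Z (-1) h.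
have {}h1 : L + -1 * M <= 0 by apply: h1.
have {}h2 : -1 * (L + -1 * M) <= 0 by apply: h2 => *; lra.
have -> : L - M = 0 by lra.
by rewrite expr0n.
Qed.

Lemma lim2_shift F L l m : lim2 F L -> lim2 (fun a b => F (a + l) (b + m)) L.
Proof.
move=> FL e /FL[s h]; exists (s + `|l| + `|m|) => a b sa sb.
have := ler_norm (- l); have := ler_norm (- m); rewrite !normrN => ? ?.
have ? := normr_ge0 l; have ? := normr_ge0 m.
by apply: h; lra.
Qed.

(** The limit is the supremum: a value within [e] of it is dominated by all later values. *)
Lemma lim2_monotone F c :
  (forall a b l m, 0 <= l -> 0 <= m -> F a b <= F (a + l) (b + m)) ->
  (forall a b, F a b <= c) -> exists2 L, lim2 F L & forall a b, F a b <= L.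
Proof.
move=> Fmono Fc; pose E := [set r | exists a b, r = F a b]%classic.
have Esup : has_sup E.
  split; first by exists (F 0 0), 0, 0.
  by exists c => _ [a [b ->]].
have FE a b : F a b <= sup E by apply: ub_le_sup; [exact: Esup.2 | exists a, b].
exists (sup E) => // e e0.
have [_ [a0 [b0 ->]] h] := sup_adherent e0 Esup.
exists (Num.max a0 b0) => a b; rewrite !ge_max => /andP[a0a _] /andP[_ b0b].
have := Fmono a0 b0 (a - a0) (b - b0); rewrite !subr_ge0 => /(_ a0a b0b).
rewrite !(addrC _ (_ - _)) !subrK => ?.
by have := FE a b; rewrite ltr_norml => ?; apply/andP; split; lra.
Qed.

End LimitAtInfinity.

(** * Linear and isometric operators *)

Section Operators.
Variables (R : realType) (H K : hilbertSpace R) (f : H -> K).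

Lemma linear_opD : linear_op f -> {morph f : x y / x + y}.
Proof. by move=> lin x y; have := lin 1 x y; rewrite !scale1r. Qed.

Lemma linear_op0 : linear_op f -> f 0 = 0.
Proof. by move=> lin; apply: (addrI (f 0)); rewrite -linear_opD// !addr0. Qed.

Lemma linear_opZ : linear_op f -> forall a, {morph f : x / a *: x}.
Proof. by move=> lin a x; have := lin a x 0; rewrite linear_op0// !addr0. Qed.

Lemma linear_opB : linear_op f -> {morph f : x y / x - y}.
Proof.
by move=> lin x y; rewrite linear_opD// -(scaleN1r y) linear_opZ// scaleN1r.
Qed.

Lemma isometry_hinner : isometry_op f ->
  forall x y, hinner (f x) (f y) = hinner x y.
Proof.
move=> [lin fnorm].
have frin x y : rinner (f x) (f y) = rinner x y.
  rewrite (polarization (f x)) (polarization x) -linear_opD// -linear_opB//.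
  by rewrite -!sqr_hnorm !fnorm.
by move=> x y; rewrite !hinnerE frin -linear_opZ// frin.
Qed.

End Operators.

(** * Norm-convergent sequences *)

Section Sequences.
Variables (R : realType) (H : hilbertSpace R).
Implicit Types (v w : nat -> H) (x y : H).

Definition hcvg v x := forall e : R, 0 < e ->
  exists N : nat, forall n : nat, (N <= n)%N -> hnorm (v n - x) < e.

Lemma hcvg_rinner v x y : hcvg v x -> forall e : R, 0 < e ->
  exists N : nat, forall n : nat, (N <= n)%N -> `|rinner (v n) y - rinner x y| < e.
Proof.
move=> vx e e0; have k0 : 0 < hnorm y + 1 by rewrite ltr_pwDr// hnorm_ge0.
have [|N NP] := vx (e / (hnorm y + 1)); first by rewrite divr_gt0.
exists N => n /NP; rewrite ltr_pdivlMr// mulrDr mulr1 => h.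
have n0 := hnorm_ge0 (v n - x).
have h1 := rinner_le_hnorm (v n - x) y.
have h2 := rinner_le_hnorm (- (v n - x)) y.
rewrite hnormN in h2; move: h1 h2; rewrite !rinnerE => h1 h2.
by rewrite ltr_norml; apply/andP; split; lra.
Qed.

(** Used to pass the defining relations of the dilation space to pointwise limits. *)
Lemma hcvg_hinner v w x x' y y' :
  (forall n, hinner (v n) y = hinner (w n) y') ->
  hcvg v x -> hcvg w x' -> hinner x y = hinner x' y'.
Proof.
move=> vw vx wx'.
suff rin z z' : (forall n, rinner (v n) z = rinner (w n) z') ->
    rinner x z = rinner x' z'.
  by rewrite !hinnerE; congr Complex; apply: rin => n; rewrite /rinner ?hinnerZr vw.
move=> rvw; apply/eqP; rewrite -subr_eq0 -normr_le0; apply/ler_addgt0Pr => e e0.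
have e2 : 0 < e / 2 by rewrite divr_gt0.
have [N1 h1] := hcvg_rinner z vx e2; have [N2 h2] := hcvg_rinner z' wx' e2.
have := h1 (maxn N1 N2); have := h2 (maxn N1 N2).
rewrite leq_maxl leq_maxr rvw => /(_ isT) {}h2 /(_ isT) {}h1.
move: h1 h2; rewrite add0r !ltr_norml ler_norml => /andP[? ?] /andP[? ?].
by apply/andP; split; lra.
Qed.

End Sequences.

(** * The dilation space *)

Section DilationSpace.
Variables (R : realType) (H : hilbertSpace R) (S T : R -> H -> H).

(* [f a b] stands for [P_H U_a V_b k], where [k] is a vector of the dilation
   space. *)
Definition dil_prop (f : R -> R -> H) : Prop :=
  [/\ forall a b l y, 0 <= l -> hinner (f (a + l) b) (S l y) = hinner (f a b) y,
      forall a b m y, 0 <= m ->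
        hinner (f a (b + m)) (T m y) = expi (a * m) * hinner (f a b) y
    & exists c : R, forall a b, hnorm (f a b) <= c].

Definition dil_pred : {pred R -> R -> H} := fun f => `[< dil_prop f >].

Lemma dil_submod_closed : submod_closed dil_pred.
Proof.
split=> [|k f g /asboolP[fS fT [c fc]] /asboolP[gS gT [d gd]]]; apply/asboolP; split.
- by move=> *; rewrite !hinner0l.
- by move=> *; rewrite !hinner0l mulr0.
- by exists (hnorm (0 : H)).
- by move=> a b l y l0; rewrite !hinner_linear fS// gS.
- by move=> a b m y m0; rewrite !hinner_linear fT// gT//; ring.
- exists (Num.sqrt (complex.Re k ^+ 2 + complex.Im k ^+ 2) * c + d) => a b.
  apply: le_trans (ler_hnormD _ _) _; rewrite lerD ?gd//.
  by rewrite hnormZ ler_wpM2l ?fc ?sqrtr_ge0.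
Qed.

HB.instance Definition _ :=
  GRing.isSubmodClosed.Build R[i] (R -> R -> H) dil_pred dil_submod_closed.

Record dil := Dil { dil_fun :> R -> R -> H; dilP : dil_fun \in dil_pred }.

HB.instance Definition _ := [isSub for dil_fun].
HB.instance Definition _ := [Choice of dil by <:].
HB.instance Definition _ := [SubChoice_isSubLmodule of dil by <:].

Lemma dil_ext (f g : dil) : (forall a b, f a b = g a b) -> f = g.
Proof. by move=> fg; apply/val_inj/funext => a; apply/funext => b; exact: fg. Qed.

Lemma dilDE (f g : dil) a b : (f + g) a b = f a b + g a b.
Proof. by []. Qed.

Lemma dilNE (f : dil) a b : (- f) a b = - f a b.
Proof. by []. Qed.

Lemma dilZE k (f : dil) a b : (k *: f) a b = k *: f a b.
Proof. by []. Qed.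

End DilationSpace.

(** Written as a real linear combination, so that limits combine by [lim2D] and [lim2Z]. *)
Lemma Re_mulD (R : realType) (k x y : R[i]) : complex.Re (k * x + y) =
  complex.Re k * complex.Re x + (- complex.Im k) * complex.Im x + complex.Re y.
Proof. by case: k x y => ? ? [? ?] [? ?] /=; ring. Qed.

Lemma Im_mulD (R : realType) (k x y : R[i]) : complex.Im (k * x + y) =
  complex.Re k * complex.Im x + complex.Im k * complex.Re x + complex.Im y.
Proof. by case: k x y => ? ? [? ?] [? ?] /=; ring. Qed.

(** * Inner product and completeness of the dilation space *)

Section DilationHilbert.
Variables (R : realType) (H : hilbertSpace R) (S T : R -> H -> H).
Hypothesis S_isom : forall l : R, 0 <= l -> isometry_op (S l).
Hypothesis T_isom : forall m : R, 0 <= m -> isometry_op (T m).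
Local Notation dil := (dil S T).
Implicit Types f g h : dil.

(** Removing [T m] first, at first coordinate a + l, produces the phase; removing [S l] then
    produces none. *)
Lemma dil_shift f a b l m y : 0 <= l -> 0 <= m ->
  hinner (f (a + l) (b + m)) (T m (S l y)) = expi ((a + l) * m) * hinner (f a b) y.
Proof.
by move=> l0 m0; have /asboolP[fS fT _] := dilP f; rewrite fT// fS.
Qed.

(* [T m (S l (f a b))] is, up to a phase, the orthogonal projection of
   [f (a + l) (b + m)] onto the range of [T m \o S l]. *)
Lemma dil_dist f a b l m : 0 <= l -> 0 <= m ->
  let u := f (a + l) (b + m) in
  let v := expi ((a + l) * m) *: T m (S l (f a b)) in
  rinner (u - v) (u - v) = rinner u u - rinner (f a b) (f a b).
Proof.
move=> l0 m0 u v.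
have vv : rinner v v = rinner (f a b) (f a b).
  by rewrite -!sqr_hnorm hnorm_expi (T_isom m0).2 (S_isom l0).2.
(* The phase in [v] cancels the one from [dil_shift], so the cross term equals |v|^2 and Pythagoras
   applies. *)
have uv : rinner u v = rinner (f a b) (f a b).
  rewrite /rinner hinnerZr dil_shift// mulrA conj_expi -expiD addNr expi0.
  by rewrite mul1r.
by rewrite !rinnerE (rinnerC v u) vv uv; ring.
Qed.

Lemma dil_mono f a b l m : 0 <= l -> 0 <= m ->
  rinner (f a b) (f a b) <= rinner (f (a + l) (b + m)) (f (a + l) (b + m)).
Proof. by move=> l0 m0; rewrite -subr_ge0 -dil_dist// rinner_ge0. Qed.

Lemma dil_lim_sqr f : exists2 L, lim2 (fun a b => rinner (f a b) (f a b)) L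
  & forall a b, rinner (f a b) (f a b) <= L.
Proof.
have /asboolP[_ _ [c fc]] := dilP f.
apply: (@lim2_monotone _ _ (c ^+ 2)) => [a b l m|a b]; first exact: dil_mono.
by rewrite -hnorm_le// (le_trans (hnorm_ge0 _) (fc 0 0)).
Qed.

(** By polarization, from the convergent squares of f + g and f - g. *)
Lemma dil_lim f g : exists L, lim2 (fun a b => rinner (f a b) (g a b)) L.
Proof.
have [L1 h1 _] := dil_lim_sqr (f + g); have [L2 h2 _] := dil_lim_sqr (f - g).
exists (4^-1 * L1 + (- 4^-1) * L2).
apply: (lim2_eq (s := 0)) (lim2D (lim2Z 4^-1 h1) (lim2Z (- 4^-1) h2)) => a b _ _.
by rewrite (polarization (f a b)) !dilDE dilNE; lra.
Qed.

Definition dil_rinner f g : R := projT1 (cid (dil_lim f g)).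

Lemma dil_rinnerP f g : lim2 (fun a b => rinner (f a b) (g a b)) (dil_rinner f g).
Proof. by rewrite /dil_rinner; case: cid. Qed.

Definition dil_inner f g : R[i] :=
  Complex (dil_rinner f g) (dil_rinner f (Complex 0 1 *: g)).

Lemma dil_innerP f g :
  lim2 (fun a b => complex.Re (hinner (f a b) (g a b)))
    (complex.Re (dil_inner f g)) /\
  lim2 (fun a b => complex.Im (hinner (f a b) (g a b)))
    (complex.Im (dil_inner f g)).
Proof.
split; first exact: dil_rinnerP.
apply: (lim2_eq (s := 0)) (dil_rinnerP f (Complex 0 1 *: g)) => a b _ _.
by rewrite Im_hinner dilZE.
Qed.

Lemma dil_inner_unique f g z :
  lim2 (fun a b => complex.Re (hinner (f a b) (g a b))) (complex.Re z) ->
  lim2 (fun a b => complex.Im (hinner (f a b) (g a b))) (complex.Im z) ->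
  dil_inner f g = z.
Proof.
have [hr hi] := dil_innerP f g => zr zi.
have := lim2_unique hr zr; have := lim2_unique hi zi.
by case: z {zr zi} => ? ? /= <- <-.
Qed.

(** For embedded vectors the pointwise inner products are constant on a quadrant, so no limit has to
    be computed. *)
Lemma dil_inner_eventually f g z s :
  (forall a b, s <= a -> s <= b -> hinner (f a b) (g a b) = z) ->
  dil_inner f g = z.
Proof.
move=> fgz; apply: dil_inner_unique.
  by apply: (lim2_eq (s := s)) (lim2_cst _) => a b sa sb; rewrite fgz.
by apply: (lim2_eq (s := s)) (lim2_cst _) => a b sa sb; rewrite fgz.
Qed.

Lemma dil_inner_linear (k : R[i]) f g h :
  dil_inner (k *: f + g) h = k * dil_inner f h + dil_inner g h.
Proof.
have [fr fi] := dil_innerP f h; have [gr gi] := dil_innerP g h.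
apply: dil_inner_unique.
  rewrite Re_mulD; apply: (lim2_eq (s := 0))
    (lim2D (lim2D (lim2Z _ fr) (lim2Z _ fi)) gr) => a b _ _.
  by rewrite dilDE dilZE hinner_linear Re_mulD.
rewrite Im_mulD; apply: (lim2_eq (s := 0))
  (lim2D (lim2D (lim2Z _ fi) (lim2Z _ fr)) gi) => a b _ _.
by rewrite dilDE dilZE hinner_linear Im_mulD.
Qed.

Lemma dil_inner_conj f g : dil_inner g f = (dil_inner f g)^*.
Proof.
have [fr fi] := dil_innerP f g; apply: dil_inner_unique.
  have -> : complex.Re (dil_inner f g)^* = complex.Re (dil_inner f g).
    by case: dil_inner.
  apply: (lim2_eq (s := 0)) fr => a b _ _; exact: rinnerC.
have -> : complex.Im (dil_inner f g)^* = -1 * complex.Im (dil_inner f g).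
  by case: dil_inner => ? ? /=; ring.
apply: (lim2_eq (s := 0)) (lim2Z (-1) fi) => a b _ _.
by rewrite (hinner_conj (f a b)); case: hinner => ? ? /=; ring.
Qed.

Lemma dil_innerE f : dil_inner f f = Complex (dil_rinner f f) 0.
Proof.
apply: dil_inner_unique; first exact: dil_rinnerP.
apply: (lim2_eq (s := 0)) (lim2_cst 0) => a b _ _.
by rewrite (ger0_Im (hinner_ge0 _)).
Qed.

Lemma dil_rinner_ub f a b : rinner (f a b) (f a b) <= dil_rinner f f.
Proof.
by have [L hL ub] := dil_lim_sqr f; rewrite (lim2_unique (dil_rinnerP f f) hL).
Qed.

Lemma dil_rinner_ge0 f : 0 <= dil_rinner f f.
Proof. exact: le_trans (rinner_ge0 _) (dil_rinner_ub f 0 0). Qed.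

Lemma dil_inner_ge0 f : 0 <= dil_inner f f.
Proof. by rewrite dil_innerE lecE /= eqxx dil_rinner_ge0. Qed.

(** The limit dominates every |f a b|^2, so if it vanishes all values do. *)
Lemma dil_inner_eq0 f : dil_inner f f = 0 -> f = 0.
Proof.
rewrite dil_innerE => /(congr1 (@complex.Re R))/= f0.
apply: dil_ext => a b; apply: rinner_eq0.
by apply/eqP; rewrite eq_le rinner_ge0 andbT -f0 dil_rinner_ub.
Qed.

(** This is [hnorm] of the Hilbert space assembled below, needed before completeness allows that
    space to be formed. *)
Definition dil_norm f : R := Num.sqrt (complex.Re (dil_inner f f)).

Lemma dil_norm_ub f a b : hnorm (f a b) <= dil_norm f.
Proof.
by rewrite hnorm_le ?sqrtr_ge0// sqr_sqrtr ?dil_rinner_ub// dil_rinner_ge0.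
Qed.

Lemma dil_norm_le f s (c : R) : 0 <= c ->
  (forall a b, s <= a -> s <= b -> hnorm (f a b) <= c) -> dil_norm f <= c.
Proof.
move=> c0 fc; rewrite -(@ler_pXn2r _ 2)// ?nnegrE ?sqrtr_ge0//.
rewrite sqr_sqrtr ?dil_rinner_ge0//.
apply: (lim2_le (s := s) _ (dil_rinnerP f f)) => a b sa sb.
by rewrite -hnorm_le// fc.
Qed.

(** The norm bounds each value, so a Cauchy sequence converges uniformly in (a, b). The limit family
    satisfies the same relations, and uniform closeness gives closeness in norm. *)
Lemma dil_complete (u : nat -> dil) :
  (forall e : R, 0 < e -> exists N : nat, forall m n : nat,
     (N <= m)%N -> (N <= n)%N -> dil_norm (u m - u n) < e) ->
  exists g : dil, forall e : R, 0 < e -> exists N : nat, forall n : nat,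
     (N <= n)%N -> dil_norm (u n - g) < e.
Proof.
move=> cauchy.
have /choice[g' g'P] : forall ab : R * R, exists x, hcvg (fun n => u n ab.1 ab.2) x.
  move=> [a b]; apply: hcomplete => e /cauchy[N NP]; exists N => m n Nm Nn.
  exact: le_lt_trans (dil_norm_ub (u m - u n) a b) (NP m n Nm Nn).
pose g a b := g' (a, b).
have gP a b : hcvg (fun n => u n a b) (g a b) by exact: g'P (a, b).
have unif (e : R) : 0 < e -> exists N, forall n, (N <= n)%N ->
    forall a b, hnorm (u n a b - g a b) <= e.
  move=> /cauchy[N NP]; exists N => n Nn a b; apply/ler_addgt0Pr => d d0.
  have [M MP] := gP a b _ d0; pose k := maxn N M.
  apply: le_trans (ler_hnorm_dist _ (u k a b) _) _; apply: lerD.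
    apply/ltW/(le_lt_trans (dil_norm_ub (u n - u k) a b)).
    by apply: NP; rewrite // leq_maxl.
  by apply/ltW/MP; rewrite leq_maxr.
have g_dil : g \in @dil_pred _ _ S T.
  apply/asboolP; split => [a b l y l0|a b m y m0|].
  - apply: hcvg_hinner (gP (a + l) b) (gP a b) => n.
    by have /asboolP[uS _ _] := dilP (u n); exact: uS.
  (* The phase is moved into the second argument, because [hcvg_hinner] compares bare inner
     products. *)
  - have -> : expi (a * m) * hinner (g a b) y =
        hinner (g a b) ((expi (a * m))^* *: y) by rewrite hinnerZr conjCK.
    apply: hcvg_hinner (gP a (b + m)) (gP a b) => n.
    by have /asboolP[_ uT _] := dilP (u n); rewrite uT// hinnerZr conjCK.
  - have [N NP] := unif 1 ltr01; exists (1 + dil_norm (u N)) => a b.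
    have -> : g a b = (g a b - u N a b) + u N a b by rewrite subrK.
    apply: le_trans (ler_hnormD _ _) _; apply: lerD; last exact: dil_norm_ub.
    by rewrite hnorm_dist NP.
exists (Dil g_dil) => e e0; have e2 : 0 < e / 2 by rewrite divr_gt0.
have [N NP] := unif _ e2; exists N => n Nn.
apply: (@le_lt_trans _ _ (e / 2)); last by lra.
by apply: (dil_norm_le (s := 0)) (ltW e2) _ => a b _ _; exact: NP.
Qed.

Definition dil_hilbert : hilbertSpace R :=
  @HilbertSpace R dil dil_inner dil_inner_linear dil_inner_conj
    dil_inner_ge0 dil_inner_eq0 dil_complete.

End DilationHilbert.

(** * Strong continuity from behaviour near zero *)

Section Continuity.
Variable R : realType.

Lemma phase_semigroup_near0 (H : hilbertSpace R) (A : R -> H -> H) :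
  isometry_semigroup A -> forall (theta : R) (x : H) (e : R), 0 < e ->
  exists2 d : R, 0 < d & forall l, 0 <= l -> l < d ->
    hnorm (expi (theta * l) *: A l x - x) < e.
Proof.
move=> [A0 _ _ Acont] theta x e e0; have e2 : 0 < e / 2 by rewrite divr_gt0.
have [d1 d10 h1] := Acont x 0 (lexx _) _ e2.
(* The summand 1 avoids a division by zero when x = 0; likewise for [theta] below. *)
have k0 : 0 < hnorm x + 1 by rewrite ltr_pwDr// hnorm_ge0.
have [|d2 d20 h2] := @cos_near0 R ((e / 2 / (hnorm x + 1)) ^+ 2).
  by rewrite exprn_gt0// divr_gt0.
have t0 : 0 < `|theta| + 1 by rewrite ltr_pwDr.
exists (Num.min d1 (d2 / (`|theta| + 1))); first by rewrite lt_min d10 divr_gt0.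
move=> l l0; rewrite lt_min => /andP[ld1]; rewrite ltr_pdivlMr// => ld2.
have {}h1 : hnorm (A l x - x) < e / 2.
  by have := h1 l l0; rewrite subr0 A0 ger0_norm//; exact.
have {}h2 : hnorm (expi (theta * l) *: x - x) < e / 2.
  rewrite hnorm_expi_sub.
  have c0 : 0 <= 2 - 2 * cos (theta * l) by have := cos_le1 (theta * l); lra.
  have lt1 : Num.sqrt (2 - 2 * cos (theta * l)) < e / 2 / (hnorm x + 1).
    rewrite -(@ltr_pXn2r _ 2)// ?nnegrE ?sqrtr_ge0//; last by rewrite ltW// divr_gt0.
    rewrite sqr_sqrtr// h2// normrM (ger0_norm l0).
    by apply: le_lt_trans ld2; rewrite mulrC ler_wpM2l// lerDl.
  rewrite ltr_pdivlMr// in lt1; apply: le_lt_trans lt1.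
  by rewrite ler_wpM2l ?sqrtr_ge0// lerDl.
have -> : expi (theta * l) *: A l x - x =
    expi (theta * l) *: (A l x - x) + (expi (theta * l) *: x - x).
  by rewrite scalerBr addrA subrK.
by apply: le_lt_trans (ler_hnormD _ _) _; rewrite hnorm_expi; lra.
Qed.

(** The isometry at the smaller of two parameters factors out of their difference, so right
    continuity at 0 suffices. Surjectivity comes from the inverse W (- l). *)
Lemma unitary_group_near0 (K : hilbertSpace R) (W : R -> K -> K) :
  (forall x, W 0 x = x) -> (forall a b x, W (a + b) x = W a (W b x)) ->
  (forall l, isometry_op (W l)) ->
  (forall x (e : R), 0 < e -> exists2 d : R, 0 < d & forall l, 0 <= l -> l < d ->
     hnorm (W l x - x) < e) ->
  unitary_group W.
Proof.
move=> W0 WD Wisom Wnear; split=> // [l|x t0 _ e e0].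
  by split=> // y; exists (W (- l) y); rewrite -WD subrr W0.
have [d d0 dP] := Wnear x e e0; exists d => // t _ td.
have Wdist s r y z : hnorm (W (s + r) y - W s z) = hnorm (W r y - z).
  by rewrite WD -linear_opB ?(Wisom s).2//; exact: (Wisom s).1.
have [t0t|/ltW tt0] := leP t0 t.
  have <- : t0 + (t - t0) = t by rewrite addrC subrK.
  rewrite Wdist; apply: dP; first by rewrite subr_ge0.
  exact: le_lt_trans (ler_norm _) td.
rewrite hnorm_dist; have {1}<- : t + (t0 - t) = t0 by rewrite addrC subrK.
rewrite Wdist; apply: dP; first by rewrite subr_ge0.
by apply: le_lt_trans (ler_norm _) _; rewrite distrC.
Qed.

End Continuity.

(** * The two translation groups and the Weyl relation *)

Section Translations.
Variables (R : realType) (H : hilbertSpace R) (S T : R -> H -> H).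
Local Notation dil := (dil S T).
Implicit Types f g : dil.

(* [P_H U_a V_b U_l k = e^(-ilb) P_H U_(a+l) V_b k] *)
Lemma dilU_subproof (l : R) f :
  (fun a b => expi (- (l * b)) *: f (a + l) b) \in @dil_pred _ _ S T.
Proof.
have /asboolP[fS fT [c fc]] := dilP f; apply/asboolP; split.
- by move=> a b p y p0; rewrite !hinnerZl addrAC fS.
(* The exponents agree: -l(b + m) + (a + l)m = am - lb. *)
- move=> a b m y m0; rewrite !hinnerZl fT// !mulrA -!expiD.
  by congr (expi _ * _); ring.
- by exists c => a b; rewrite hnorm_expi.
Qed.

Definition dilU l f : dil := Dil (dilU_subproof l f).

Lemma dilUE l f a b : dilU l f a b = expi (- (l * b)) *: f (a + l) b.
Proof. by []. Qed.

Lemma dilV_subproof (m : R) f : (fun a b => f a (b + m)) \in @dil_pred _ _ S T.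
Proof.
have /asboolP[fS fT [c fc]] := dilP f; apply/asboolP; split.
- by move=> a b p y p0; rewrite fS.
- by move=> a b p y p0; rewrite addrAC fT.
- by exists c => a b.
Qed.

Definition dilV m f : dil := Dil (dilV_subproof m f).

Lemma dilU0 f : dilU 0 f = f.
Proof. by apply: dil_ext => a b /=; rewrite mul0r oppr0 expi0 scale1r addr0. Qed.

Lemma dilUD l m f : dilU (l + m) f = dilU l (dilU m f).
Proof.
apply: dil_ext => a b /=; rewrite scalerA -expiD -addrA.
by congr (expi _ *: _); ring.
Qed.

Lemma dilU_linear l k f g : dilU l (k *: f + g) = k *: dilU l f + dilU l g.
Proof.
apply: dil_ext => a b; rewrite dilDE dilZE !dilUE dilDE dilZE scalerDr.
by rewrite !scalerA (mulrC k).
Qed.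

Lemma dilV0 f : dilV 0 f = f.
Proof. by apply: dil_ext => a b /=; rewrite addr0. Qed.

Lemma dilVD l m f : dilV (l + m) f = dilV l (dilV m f).
Proof. by apply: dil_ext => a b /=; rewrite addrA. Qed.

Lemma dilUV l m f : dilU l (dilV m f) = expi (l * m) *: dilV m (dilU l f).
Proof.
apply: dil_ext => a b; rewrite dilZE /= scalerA -expiD.
by congr (expi _ *: _); ring.
Qed.

End Translations.

(** * Unitarity and strong continuity of the translations *)

Section DilationGroups.
Variables (R : realType) (H : hilbertSpace R) (S T : R -> H -> H).
Hypotheses (S_sg : isometry_semigroup S) (T_sg : isometry_semigroup T).

Lemma isometry_semigroupP (A : R -> H -> H) : isometry_semigroup A ->
  forall l, 0 <= l -> isometry_op (A l).
Proof. by case. Qed.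

Let S_isom := isometry_semigroupP S_sg.
Let T_isom := isometry_semigroupP T_sg.
Local Notation dil := (dil S T).
Local Notation K := (dil_hilbert S_isom T_isom).
Implicit Types f g : K.

Lemma dil_hnorm_ub f a b : hnorm ((f : dil) a b) <= hnorm f.
Proof. exact: dil_norm_ub. Qed.

(** The norm is a limit at infinity, hence unaffected by a shift. *)
Lemma dil_hnorm_shift f g l m :
  (forall a b, hnorm ((g : dil) a b) = hnorm ((f : dil) (a + l) (b + m))) ->
  hnorm g = hnorm f.
Proof.
move=> gf; rewrite /hnorm; congr Num.sqrt.
apply: (@lim2_unique _ (fun a b => rinner ((g : dil) a b) ((g : dil) a b))).
  exact: dil_rinnerP.
apply: (lim2_eq (s := 0)) (lim2_shift l m (dil_rinnerP S_isom T_isom f f)).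
by move=> a b _ _; rewrite -!sqr_hnorm gf.
Qed.

(** By [dil_dist] the squared left side is a difference of squared norms of values, and |f| bounds
    the later one. So a value that nearly attains the norm nearly determines all later values. *)
Lemma dil_dist_le f (a b l m e : R) : 0 <= l -> 0 <= m -> 0 <= e ->
  hnorm f ^+ 2 - hnorm ((f : dil) a b) ^+ 2 <= e ^+ 2 ->
  hnorm ((f : dil) (a + l) (b + m) - expi ((a + l) * m) *: T m (S l ((f : dil) a b)))
    <= e.
Proof.
move=> l0 m0 e0 fe; rewrite hnorm_le// dil_dist//; apply: le_trans fe.
rewrite -!sqr_hnorm lerD2r ler_pXn2r ?nnegrE ?hnorm_ge0//.
exact: dil_hnorm_ub.
Qed.

(** Beyond (a, b) each of f and g is within [e] of the image of its value at (a, b) under one common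
    isometry, and these images are within [d]. *)
Lemma dil_hnorm_sub_le f g (a b e d : R) : 0 <= e -> hnorm g = hnorm f ->
  hnorm ((f : dil) a b) <= hnorm ((g : dil) a b) ->
  hnorm f ^+ 2 - hnorm ((f : dil) a b) ^+ 2 <= e ^+ 2 ->
  hnorm ((g : dil) a b - (f : dil) a b) <= d ->
  hnorm (g - f) <= e + d + e.
Proof.
move=> e0 gf fgab fe fgd.
have ge : hnorm g ^+ 2 - hnorm ((g : dil) a b) ^+ 2 <= e ^+ 2.
  apply: le_trans fe; rewrite gf lerD2l lerN2.
  by rewrite ler_pXn2r ?nnegrE ?hnorm_ge0.
have d0 : 0 <= d by exact: le_trans (hnorm_ge0 _) fgd.
apply: (@dil_norm_le _ _ _ _ S_isom T_isom _ (Num.max a b)) => [|a' b'].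
  by rewrite !addr_ge0.
rewrite !ge_max => /andP[aa' _] /andP[_ bb'].
have l0 : 0 <= a' - a by rewrite subr_ge0.
have m0 : 0 <= b' - b by rewrite subr_ge0.
have := dil_dist_le l0 m0 e0 fe; have := dil_dist_le l0 m0 e0 ge.
rewrite !(addrC _ (_ - _)) !subrK dilDE dilNE.
set vg := _ *: T _ (S _ (_ g _ _)); set vf := _ *: T _ _ => hg hf.
apply: le_trans (ler_hnorm_dist _ vf _) _; apply: lerD; last by rewrite hnorm_dist.
apply: le_trans (ler_hnorm_dist _ vg _) _; apply: lerD => //.
have [Tlin Tnorm] := T_isom m0; have [Slin Snorm] := S_isom l0.
rewrite /vg /vf -scalerBr -linear_opB// -linear_opB//.
by rewrite hnorm_expi Tnorm Snorm.
Qed.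

(** Treats both groups at once: [theta a b] is - b for [dilU] and a for [dilV]. *)
Lemma dil_group_near0 (W : R -> K -> K) (A : R -> H -> H) (theta : R -> R -> R) :
  isometry_semigroup A -> (forall l, isometry_op (W l)) ->
  (forall f a b l, 0 <= l ->
    hnorm ((f : dil) a b) <= hnorm ((W l f : dil) a b)) ->
  (forall f a b l (e : R), 0 <= l -> 0 <= e ->
    hnorm f ^+ 2 - hnorm ((f : dil) a b) ^+ 2 <= e ^+ 2 ->
    hnorm ((W l f : dil) a b - expi (theta a b * l) *: A l ((f : dil) a b)) <= e) ->
  forall f (e : R), 0 < e -> exists2 d : R, 0 < d & forall l, 0 <= l -> l < d ->
    hnorm (W l f - f) < e.
Proof.
move=> A_sg Wisom Wmono Wdist f e e0.
(* Four errors of size [c] arise: two from [dil_hnorm_sub_le], one from [Wdist], one from the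
   continuity of [A]. *)
pose c := e / 5; have c0 : 0 < c by rewrite divr_gt0.
have [|s sP] := dil_rinnerP S_isom T_isom f f (e := c ^+ 2); first exact: exprn_gt0.
have fc : hnorm f ^+ 2 - hnorm ((f : dil) s s) ^+ 2 <= c ^+ 2.
  have := sP s s (lexx _) (lexx _); rewrite distrC -sqr_hnorm => /ltW h.
  apply: le_trans h; apply: le_trans (ler_norm _).
  by rewrite sqr_hnorm.
have [d d0 dP] := phase_semigroup_near0 A_sg (theta s s) ((f : dil) s s) c0.
exists d => // l l0 ld.
apply: (@le_lt_trans _ _ (c + (c + c) + c)); last by rewrite /c; lra.
have Wl : hnorm (W l f) = hnorm f by exact: (Wisom l).2.
apply: (dil_hnorm_sub_le (ltW c0) Wl (Wmono _ _ _ _ l0) fc).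
apply: le_trans (ler_hnorm_dist _ (expi (theta s s * l) *: A l ((f : dil) s s)) _) _.
by apply: lerD; [exact: Wdist (ltW c0) fc | exact/ltW/dP].
Qed.

Lemma dilU_group : unitary_group (fun l f => dilU l f : K).
Proof.
have [T0 _ _ _] := T_sg.
have Uisom l : isometry_op (fun f : K => dilU l f : K).
  split=> [k f g|f]; first exact: dilU_linear.
  by apply: (@dil_hnorm_shift _ _ l 0) => a b /=; rewrite hnorm_expi addr0.
apply: unitary_group_near0 => //; [exact: dilU0 | exact: dilUD |].
apply: (dil_group_near0 (A := S) (theta := fun a b => - b)) => //.
  move=> f a b l l0 /=; rewrite hnorm_expi hnorm_le ?hnorm_ge0// sqr_hnorm.
  by have := dil_mono S_isom T_isom f a b l0 (lexx 0); rewrite addr0.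
move=> f a b l e l0 e0 /(dil_dist_le l0 (lexx 0) e0).
rewrite addr0 mulr0 expi0 scale1r T0 /= => h.
by rewrite mulNr (mulrC b) -scalerBr hnorm_expi.
Qed.

Lemma dilV_group : unitary_group (fun m f => dilV m f : K).
Proof.
have [S0 _ _ _] := S_sg.
have Visom m : isometry_op (fun f : K => dilV m f : K).
  split=> [k f g|f]; first exact: dil_ext.
  by apply: (@dil_hnorm_shift _ _ 0 m) => a b /=; rewrite addr0.
apply: unitary_group_near0 => //; [exact: dilV0 | exact: dilVD |].
apply: (dil_group_near0 (A := T) (theta := fun a b => a)) => //.
  move=> f a b m m0 /=; rewrite hnorm_le ?hnorm_ge0// sqr_hnorm.
  by have := dil_mono S_isom T_isom f a b (lexx 0) m0; rewrite addr0.
move=> f a b m e m0 e0 /(dil_dist_le (lexx 0) m0 e0).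
by rewrite addr0 S0.
Qed.

End DilationGroups.

(** * The embedding and the theorem *)

(** Makes |a| and |b| admissible shifts l and m in [dilJ_form] for all real a and b. *)
Lemma addr_norm_ge0 (R : realType) (t : R) : 0 <= t + `|t|.
Proof. by have := ler_norm (- t); rewrite normrN; lra. Qed.

Section Embedding.
Variables (R : realType) (H : hilbertSpace R) (S T : R -> H -> H).
Hypotheses (S_sg : isometry_semigroup S) (T_sg : isometry_semigroup T).
Hypothesis ST : forall (l m : R) (x : H), 0 <= l -> 0 <= m ->
  S l (T m x) = expi (l * m) *: T m (S l x).

Let S_isom := isometry_semigroupP S_sg.
Let T_isom := isometry_semigroupP T_sg.
Local Notation dil := (dil S T).
Local Notation K := (dil_hilbert S_isom T_isom).

(* [<P_H U_a V_b x, y>], written with the isometries only by means of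
   [y = (V_m U_l)^* (T_m S_l y)]; valid whenever [l, m, a + l, b + m >= 0]. *)
Definition dilJ_form x (a b l m : R) y : R[i] :=
  expi (- ((a + l) * m)) * hinner (S (a + l) (T (b + m) x)) (T m (S l y)).

(** The commutation relation brings the extra [T q], then the extra [S p], outermost on both sides,
    where it cancels by isometry; the prefactor compensates the phases. *)
Lemma dilJ_form_shift x a b l m p q y :
  0 <= l -> 0 <= m -> 0 <= a + l -> 0 <= b + m -> 0 <= p -> 0 <= q ->
  dilJ_form x a b (l + p) (m + q) y = dilJ_form x a b l m y.
Proof.
have [_ SD _ _] := S_sg; have [_ TD _ _] := T_sg.
move=> l0 m0 al0 bm0 p0 q0; transitivity (dilJ_form x a b (l + p) m y).
  have alp0 : 0 <= a + (l + p) by rewrite addrA addr_ge0.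
  rewrite /dilJ_form (addrA b) (addrC (b + m)) (addrC m) !(TD q)// ST//.
  rewrite hinnerZl (isometry_hinner (T_isom q0)) mulrA -expiD.
  by congr (expi _ * _); ring.
rewrite /dilJ_form (addrA a) (addrC (a + l)) (addrC l) !(SD p)//.
have -> z : T m (S p z) = (expi (- (p * m))) *: S p (T m z).
  by rewrite ST// scalerA -expiD addNr expi0 scale1r.
rewrite hinnerZr conj_expi (isometry_hinner (S_isom p0)) mulrA -expiD.
by congr (expi _ * _); ring.
Qed.

(** Riesz is applied with shifts |a| and |b|. Any other admissible pair gives the same form, by
    comparing both with their sum. *)
Lemma dilJ_ex x a b : exists z : H, forall l m y,
  0 <= l -> 0 <= m -> 0 <= a + l -> 0 <= b + m ->
  hinner z y = dilJ_form x a b l m y.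
Proof.
have [Slin Snorm] := S_isom (normr_ge0 a).
have [Tlin Tnorm] := T_isom (normr_ge0 b).
have [_ Snorm'] := S_isom (addr_norm_ge0 a).
have [_ Tnorm'] := T_isom (addr_norm_ge0 b).
have [k y z|y|z zP] := @riesz R H (dilJ_form x a b `|a| `|b|) (hnorm x).
- by rewrite /dilJ_form Slin Tlin hinnerDr hinnerZr; ring.
- rewrite /dilJ_form -hinnerZl; apply: le_trans (rinner_le_hnorm _ _) _.
  by rewrite hnorm_expi Snorm' Tnorm' Tnorm Snorm.
exists z => l m y l0 m0 al0 bm0; rewrite zP.
rewrite -(@dilJ_form_shift x a b `|a| `|b| l m) ?addr_norm_ge0//.
by rewrite (addrC _ l) (addrC _ m) dilJ_form_shift.
Qed.

Definition dilJ_fun x a b : H := projT1 (cid (dilJ_ex x a b)).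

Lemma dilJ_funP x a b l m y :
  0 <= l -> 0 <= m -> 0 <= a + l -> 0 <= b + m ->
  hinner (dilJ_fun x a b) y = dilJ_form x a b l m y.
Proof. by rewrite /dilJ_fun; case: cid => z /= zP; exact: zP. Qed.

Lemma dilJ_subproof x : dilJ_fun x \in @dil_pred _ _ S T.
Proof.
have [_ SD _ _] := S_sg; have [_ TD _ _] := T_sg.
apply/asboolP; split.
- move=> a b l y l0; have la := normr_ge0 a; have mb := normr_ge0 b.
  have a0 := addr_norm_ge0 a; have b0 := addr_norm_ge0 b.
  rewrite (@dilJ_funP _ _ _ `|a| `|b|)//; last by rewrite addrAC addr_ge0.
  have al0 : 0 <= `|a| + l by rewrite addr_ge0.
  have aal0 : 0 <= a + (`|a| + l) by rewrite addrA addr_ge0.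
  rewrite (@dilJ_funP _ _ _ (`|a| + l) `|b|)//.
  by rewrite /dilJ_form (SD `|a| l)// addrA (addrAC a).
- move=> a b m y m0; have la := normr_ge0 a; have mb := normr_ge0 b.
  have a0 := addr_norm_ge0 a; have b0 := addr_norm_ge0 b.
  rewrite (@dilJ_funP _ _ _ `|a| `|b|)//; last by rewrite addrAC addr_ge0.
  have bm0 : 0 <= `|b| + m by rewrite addr_ge0.
  have bbm0 : 0 <= b + (`|b| + m) by rewrite addrA addr_ge0.
  rewrite (@dilJ_funP _ _ _ `|a| (`|b| + m))//.
  (* Moving S_|a| past [T m] gives the phase needed to match e^(iam) and the two prefactors. *)
  rewrite /dilJ_form (TD `|b| m)// (ST y la m0) !(linear_opZ (T_isom mb).1).
  rewrite hinnerZr conj_expi.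
  rewrite addrA (addrAC b) !mulrA -!expiD.
  by congr (expi _ * _); ring.
- exists (hnorm x) => a b; set z := dilJ_fun x a b.
  have la := normr_ge0 a; have mb := normr_ge0 b.
  (* Testing [z] against itself gives |z|^2 <= |x| |z|, hence |z| <= |x|. *)
  have zz : rinner z z <= hnorm x * hnorm z.
    rewrite /rinner (@dilJ_funP _ _ _ `|a| `|b|) ?addr_norm_ge0// /dilJ_form -hinnerZl.
    apply: le_trans (rinner_le_hnorm _ _) _.
    rewrite hnorm_expi (S_isom (addr_norm_ge0 a)).2 (T_isom (addr_norm_ge0 b)).2.
    by rewrite (T_isom mb).2 (S_isom la).2.
  have [z0|z0] := eqVneq (hnorm z) 0; first by rewrite z0 hnorm_ge0.
  rewrite -sqr_hnorm expr2 in zz.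
  by rewrite -(ler_pM2r (x := hnorm z))// lt_def z0 hnorm_ge0.
Qed.

Definition dilJ x : K := Dil (dilJ_subproof x).

Lemma dilJE x a b : 0 <= a -> 0 <= b -> (dilJ x : dil) a b = S a (T b x).
Proof.
have [S0 _ _ _] := S_sg; have [T0 _ _ _] := T_sg.
move=> a0 b0; apply: hinner_inj => y /=.
rewrite (@dilJ_funP _ _ _ 0 0) ?addr0// /dilJ_form.
by rewrite !addr0 mulr0 oppr0 expi0 mul1r S0 T0.
Qed.

Lemma dilJ_embedding : hembedding dilJ.
Proof.
split=> [k x y|x y].
  apply: dil_ext => a b; apply: hinner_inj => z.
  have -> : (k *: dilJ x + dilJ y : dil) a b = k *: dilJ_fun x a b + dilJ_fun y a b.
    by [].
  rewrite hinner_linear !(@dilJ_funP _ _ _ `|a| `|b|) ?addr_norm_ge0// /dilJ_form.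
  rewrite (T_isom (addr_norm_ge0 b)).1 (S_isom (addr_norm_ge0 a)).1 hinner_linear.
  by ring.
apply: (@dil_inner_eventually _ _ _ _ S_isom T_isom _ _ _ 0) => a b a0 b0.
by rewrite !dilJE// (isometry_hinner (S_isom a0)) (isometry_hinner (T_isom b0)).
Qed.

(** For a, b >= 0 the factor e^(-ilb) cancels the phase of S_l T_b, leaving S_a T_b S_l x, which is
    paired with S_a T_b y. *)
Lemma dilU_compression l : 0 <= l ->
  compression dilJ (fun f : K => dilU l f : K) (S l).
Proof.
have [_ SD _ _] := S_sg.
move=> l0 x y; apply: (@dil_inner_eventually _ _ _ _ S_isom T_isom _ _ _ 0).
move=> a b a0 b0; rewrite dilUE !dilJE ?addr_ge0// SD//.
rewrite ST// (linear_opZ (S_isom a0).1) scalerA -expiD addNr expi0 scale1r.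
by rewrite (isometry_hinner (S_isom a0)) (isometry_hinner (T_isom b0)).
Qed.

Lemma dilV_compression m : 0 <= m ->
  compression dilJ (fun f : K => dilV m f : K) (T m).
Proof.
have [_ TD _ _] := T_sg.
move=> m0 x y; apply: (@dil_inner_eventually _ _ _ _ S_isom T_isom _ _ _ 0).
move=> a b a0 b0.
have -> : dilV m (dilJ x : dil) a b = (dilJ x : dil) a (b + m) by [].
rewrite !dilJE ?addr_ge0// TD//.
by rewrite (isometry_hinner (S_isom a0)) (isometry_hinner (T_isom b0)).
Qed.

End Embedding.

Theorem theorem4p2 (R : realType) (H : hilbertSpace R) (S T : R -> H -> H) :
  isometry_semigroup S -> isometry_semigroup T ->
  (forall (l m : R) (x : H), 0 <= l -> 0 <= m ->
      S l (T m x) = expi (l * m) *: T m (S l x)) ->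
  exists (K : hilbertSpace R) (J : H -> K) (U V : R -> K -> K),
    [/\ hembedding J, unitary_group U, unitary_group V
      & (forall (l m : R) (y : K), U l (V m y) = expi (l * m) *: V m (U l y))] /\
    (forall l : R, 0 <= l -> compression J (U l) (S l)) /\
    (forall m : R, 0 <= m -> compression J (V m) (T m)).
Proof.
move=> S_sg T_sg ST.
exists (dil_hilbert (isometry_semigroupP S_sg) (isometry_semigroupP T_sg)).
exists (dilJ S_sg T_sg ST), (fun l f => dilU l f), (fun m f => dilV m f).
split; first split.
- exact: dilJ_embedding.
- exact: dilU_group.
- exact: dilV_group.
- exact: dilUV.
split; [exact: dilU_compression | exact: dilV_compression].
Qed.
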